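(* For every $m\ge1$ there exists a finite subset $S_m\subset O(\mathbb{R}^4)$ such that $$\tfrac{1}{\sqrt{2m}}(D_4)_{2m}=\bigsqcup_{\sigma\in S_m}\sigma\big(\tfrac{1}{\sqrt2}\mathbf{D}_4\big),$$ a disjoint union.
   Context: $D_4=\{x\in\mathbb{Z}^4: x_1+x_2+x_3+x_4\equiv0\bmod2\}$ and $(D_4)_n=\{x\in D_4: x_1^2+\dots+x_4^2=n\}$; $cY=\{cy:y\in Y\}$. $\mathbf{D}_4=(D_4)_2$ is the $D_4$ root system, consisting of the 24 permutations of $(\pm1,\pm1,0,0)$. $O(\mathbb{R}^4)$ is the orthogonal group of $\mathbb{R}^4$. *)

(* Defs.v *)
From HB Require Import structures.
From mathcomp Require Import all_boot all_order all_algebra.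
From mathcomp Require Import all_classical all_reals.

Set Implicit Arguments.
Unset Strict Implicit.
Unset Printing Implicit Defensive.

Import Order.TTheory GRing.Theory Num.Theory.
Local Open Scope classical_set_scope.
Local Open Scope ring_scope.

Section Lattice.
Variable R : realType.

Definition D4_lattice : set 'cV[R]_4 :=
  [set map_mx intr z | z in [set z : 'cV[int]_4 | (2 %| \sum_i z i 0)%Z]].

(* The norm n is the squared Euclidean norm. *)
Definition D4_shell (n : nat) : set 'cV[R]_4 :=
  [set x | D4_lattice x /\ \sum_i x i 0 ^+ 2 = n%:R].

Definition D4_roots : set 'cV[R]_4 := D4_shell 2.

Definition dilate (c : R) (Y : set 'cV[R]_4) : set 'cV[R]_4 :=
  [set c *: y | y in Y].

(* Orthogonal transformations of R^4, as matrices acting on column vectors by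
   left multiplication. *)
Definition orthogonal_group : set 'M[R]_4 :=
  [set A | A^T *m A = 1%:M].

End Lattice.

Arguments D4_lattice R : clear implicits.
Arguments D4_shell R n : clear implicits.
Arguments D4_roots R : clear implicits.
Arguments orthogonal_group R : clear implicits.

(* Main.v *)
Require Import Defs.
From mathcomp Require Import all_boot all_order all_algebra.
From mathcomp Require Import all_classical all_reals.
From mathcomp Require Import ring zify.

Import Order.TTheory GRing.Theory Num.Theory.
Local Open Scope classical_set_scope.
Local Open Scope ring_scope.

(** Identify R^4 with the quaternions. The 24 Hurwitz units form a group U,
    the lattice D_4 is stable under right multiplication by U, and
    D_4-roots = (1+i)U. Hence the shell (D_4)_{2m} is a disjoint union of
    cosets xU, and, up to scaling, xU is the image of the roots under left
    multiplication by x(1-i), which is a similarity. *)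

Section Quaternions.
Set Implicit Arguments.
Unset Strict Implicit.
Variable R : realType.
Implicit Types (x y z u v : 'cV[R]_4) (a b c d : R).

(** * Quaternion multiplication as real matrices *)

Definition quat a b c d : 'cV[R]_4 := \col_i [:: a; b; c; d]`_i.

Lemma quatE x : x = quat (x 0 0) (x 1 0) (x 2 0) (x 3 0).
Proof.
apply/matrixP => i j; rewrite ord1 mxE.
by case: i => [[|[|[|[|//]]]] ?]; congr (x _ _); apply: val_inj.
Qed.

Definition sqnorm x : R := \sum_i x i 0 ^+ 2.

Lemma sqnorm_quat a b c d :
  sqnorm (quat a b c d) = a ^+ 2 + b ^+ 2 + c ^+ 2 + d ^+ 2.
Proof. by rewrite /sqnorm !big_ord_recl big_ord0 !mxE /= addr0 !addrA. Qed.

(** The matrix of y ↦ xy in the basis 1, i, j, k. No separate product is introduced: xy is written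
    [lmulq x *m y] throughout. *)
Definition lmulq x : 'M[R]_4 := \matrix_(i, j)
  (nth [::] [:: [:: x 0 0; - x 1 0; - x 2 0; - x 3 0];
                [:: x 1 0;   x 0 0; - x 3 0;   x 2 0];
                [:: x 2 0;   x 3 0;   x 0 0; - x 1 0];
                [:: x 3 0; - x 2 0;   x 1 0;   x 0 0]] i)`_j.

Definition conjq x := quat (x 0 0) (- x 1 0) (- x 2 0) (- x 3 0).

Lemma lmulq_quat a b c d p q r s :
  lmulq (quat a b c d) *m quat p q r s =
  quat (a * p - b * q - c * r - d * s) (b * p + a * q - d * r + c * s)
       (c * p + d * q + a * r - b * s) (d * p - c * q + b * r + a * s).
Proof.
apply/matrixP => i j; rewrite ord1 !mxE !big_ord_recl big_ord0 !mxE /=.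
by case: i => [[|[|[|[|//]]]] ?] /=; ring.
Qed.

(** Associativity of the quaternion product, (xy)z = x(yz), in matrix form. *)
Lemma lmulqM x y : lmulq (lmulq x *m y) = lmulq x *m lmulq y.
Proof.
rewrite (quatE x) (quatE y) lmulq_quat; apply/matrixP => i j.
rewrite !mxE !big_ord_recl big_ord0 !mxE /=.
by case: i => [[|[|[|[|//]]]] ?]; case: j => [[|[|[|[|//]]]] ?] /=; ring.
Qed.

Lemma trmx_lmulq x : (lmulq x)^T = lmulq (conjq x).
Proof.
apply/matrixP => i j; rewrite !mxE /=.
by case: i => [[|[|[|[|//]]]] ?]; case: j => [[|[|[|[|//]]]] ?] /=;
  rewrite ?opprK.
Qed.

Lemma lmulq_conjl x : lmulq (conjq x) *m x = quat (sqnorm x) 0 0 0.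
Proof.
rewrite {2 3}(quatE x) lmulq_quat sqnorm_quat; congr quat; ring.
Qed.

Lemma lmulq_real a : lmulq (quat a 0 0 0) = a%:M.
Proof.
apply/matrixP => i j; rewrite !mxE /=.
by case: i => [[|[|[|[|//]]]] ?]; case: j => [[|[|[|[|//]]]] ?] /=;
  rewrite ?oppr0 ?mulr1n ?mulr0n.
Qed.

Lemma lmulq_tr_mul x : (lmulq x)^T *m lmulq x = (sqnorm x)%:M.
Proof. by rewrite trmx_lmulq -lmulqM lmulq_conjl lmulq_real. Qed.

Lemma lmulqC_mul x : lmulq x *m lmulq (conjq x) = (sqnorm x)%:M.
Proof.
rewrite -lmulqM -lmulq_real (quatE x) /conjq lmulq_quat sqnorm_quat.
by congr (lmulq (quat _ _ _ _)); rewrite !mxE /=; ring.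
Qed.

(** Euler's four-square identity. *)
Lemma sqnormM x y : sqnorm (lmulq x *m y) = sqnorm x * sqnorm y.
Proof.
rewrite (quatE x) (quatE y) lmulq_quat !sqnorm_quat; ring.
Qed.

Lemma sqnormZ a x : sqnorm (a *: x) = a ^+ 2 * sqnorm x.
Proof.
by rewrite /sqnorm mulr_sumr; apply: eq_bigr => i _; rewrite mxE exprMn.
Qed.

(** * The lattice D_4 and the Hurwitz order *)

Lemma D4_latticeP x : D4_lattice R x <->
  exists t p q r : int,
    x = quat (2 * t%:~R - p%:~R - q%:~R - r%:~R) p%:~R q%:~R r%:~R.
Proof.
split=> [[z /dvdzP[t zt] <-]|[t [p [q [r ->]]]]].
  (* The coordinate sum is 2t, so the first coordinate can be solved for. Parity thus becomes a free
     integer parameter, and later memberships reduce to explicit witnesses. *)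
  exists t, (z 1 0), (z 2 0), (z 3 0).
  rewrite [LHS]quatE !mxE; congr quat.
  have -> : z 0 0 = t * 2 - z 1 0 - z 2 0 - z 3 0.
    rewrite -zt !big_ord_recl big_ord0.
    have -> : lift ord0 ord0 = 1 :> 'I_4 by apply: val_inj.
    have -> : lift ord0 (lift ord0 ord0) = 2 :> 'I_4 by apply: val_inj.
    have -> : lift ord0 (lift ord0 (lift ord0 ord0)) = 3 :> 'I_4
      by apply: val_inj.
    ring.
  by ring.
exists (\col_i [:: 2 * t - p - q - r; p; q; r]`_i).
  apply/dvdzP; exists t.
  by rewrite !big_ord_recl big_ord0 !mxE /=; ring.
apply/matrixP => i j; rewrite !mxE.
by case: i => [[|[|[|[|//]]]] ?] /=; ring.
Qed.

(** Coordinates in the Z-basis h = (1+i+j+k)/2, i, j, k of the Hurwitz order, which treats integral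
    and half-integral quaternions uniformly; 1 = 2h - i - j - k. *)
Definition hurwitz : set 'cV[R]_4 := [set u | exists k l m n : int,
  u = quat (k%:~R / 2) (k%:~R / 2 + l%:~R) (k%:~R / 2 + m%:~R)
           (k%:~R / 2 + n%:~R)].

Definition hurwitz_units : set 'cV[R]_4 :=
  [set u | hurwitz u /\ sqnorm u = 1].

Lemma D4_mul_hurwitz x u :
  D4_lattice R x -> hurwitz u -> D4_lattice R (lmulq x *m u).
Proof.
move=> /D4_latticeP[t [p [q [r ->]]]] [k [l [m [n ->]]]].
rewrite lmulq_quat; apply/D4_latticeP.
(* The witnesses are half the coordinate sum of the product, then its i, j, k coordinates. The
   halves coming from h cancel because x has even coordinate sum. *)
exists (k * (2 * t - p - q - r) + l * (t - p - q) + m * (t - q - r)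
        + n * (t - p - r)).
exists (k * (t - r) + (2 * t - p - q - r) * l - r * m + q * n).
exists (k * (t - p) + r * l + (2 * t - p - q - r) * m - p * n).
exists (k * (t - q) - q * l + p * m + (2 * t - p - q - r) * n).
by congr quat; field.
Qed.

Lemma hurwitzM v u : hurwitz v -> hurwitz u -> hurwitz (lmulq v *m u).
Proof.
move=> [K [P [Q [T ->]]]] [k [l [m [n ->]]]]; rewrite lmulq_quat.
(* Twice the real part of the product, then the excess of each imaginary coordinate over the real
   part; for instance h^2 = h - 1. *)
exists (- K * k - K * (l + m + n) - k * (P + Q + T)
        - 2 * (P * l + Q * m + T * n)).
exists (K * k + k * (P + Q) + K * (l + n) - T * m + Q * n
        + (P * l + Q * m + T * n)).
exists (K * k + k * (Q + T) + K * (l + m) + T * l - P * n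
        + (P * l + Q * m + T * n)).
exists (K * k + k * (P + T) + K * (m + n) - Q * l + P * m
        + (P * l + Q * m + T * n)).
by congr quat; field.
Qed.

Lemma hurwitz_unitsM v u :
  hurwitz_units v -> hurwitz_units u -> hurwitz_units (lmulq v *m u).
Proof.
move=> [Hv Nv] [Hu Nu]; split; first exact: hurwitzM.
by rewrite sqnormM Nv Nu mulr1.
Qed.

Lemma hurwitz_units_conj u : hurwitz_units u -> hurwitz_units (conjq u).
Proof.
move=> [[k [l [m [n ->]]]] Nu]; split; last first.
  by apply: etrans Nu; rewrite /conjq !sqnorm_quat !mxE /=; ring.
exists k, (- k - l), (- k - m), (- k - n).
by rewrite /conjq !mxE /=; congr quat; field.
Qed.

Lemma hurwitz_units1 : hurwitz_units (quat 1 0 0 0).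
Proof.
split; last by rewrite sqnorm_quat; ring.
by exists 2, (-1), (-1), (-1); congr quat; field.
Qed.

(** The inverse of 1+i is (1-i)/2. It carries all of D_4 into the Hurwitz order and halves squared
    norms, so roots go to units. *)
Lemma D4_rootsE :
  D4_roots R = mulmx (lmulq (quat 1 1 0 0)) @` hurwitz_units.
Proof.
have N1i (a : R) : a ^+ 2 = 1 -> sqnorm (quat 1 a 0 0) = 2.
  by move=> a2; rewrite sqnorm_quat a2; ring.
rewrite eqEsubset; split=> [r [Dr Nr]|_ [u [Hu Nu] <-]].
  exists (2^-1 *: (lmulq (quat 1 (-1) 0 0) *m r)); last first.
    have -> : quat 1 (-1) 0 0 = conjq (quat 1 1 0 0).
      by rewrite /conjq !mxE /= oppr0.
    rewrite -scalemxAr mulmxA lmulqC_mul N1i ?expr1n// mul_scalar_mx scalerA.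
    by rewrite mulVf ?scale1r ?pnatr_eq0.
  split; last first.
    rewrite sqnormZ sqnormM N1i ?sqrrN ?expr1n//.
    by rewrite /sqnorm Nr; field.
  move: Dr => /D4_latticeP[t [p [q [s ->]]]]; rewrite lmulq_quat.
  exists (2 * t - q - s), (- (2 * t - p - q - s)), (q + s - t), (s - t).
  by rewrite [LHS]quatE !mxE /=; congr quat; field.
split; last by rewrite -[LHS]/(sqnorm _) sqnormM Nu N1i ?expr1n ?mulr1.
apply: D4_mul_hurwitz => //; apply/D4_latticeP; exists 1, 1, 0, 0.
by congr quat; ring.
Qed.

(** * Cosets of the unit group, and finiteness of the shells *)

Definition unit_coset x : set 'cV[R]_4 := mulmx (lmulq x) @` hurwitz_units.

Lemma unit_coset_refl x : unit_coset x x.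
Proof.
exists (quat 1 0 0 0); first exact: hurwitz_units1.
by rewrite [in LHS](quatE x) lmulq_quat [RHS]quatE; congr quat; ring.
Qed.

(** The conjugate of a unit u is its inverse, so left multiplication by u permutes the units: xuU =
    xU. *)
Lemma unit_coset_eq x y : unit_coset x y -> unit_coset y = unit_coset x.
Proof.
move=> [u Uu <-]; rewrite eqEsubset; split=> _ [v Uv <-].
  by exists (lmulq u *m v); [exact: hurwitz_unitsM|rewrite lmulqM mulmxA].
exists (lmulq (conjq u) *m v).
  by apply: hurwitz_unitsM => //; exact: hurwitz_units_conj.
rewrite lmulqM -mulmxA; congr (_ *m _).
by rewrite mulmxA lmulqC_mul; case: Uu => _ ->; rewrite mul1mx.
Qed.

Lemma unit_coset_shell n x :
  D4_shell R n x -> unit_coset x `<=` D4_shell R n.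
Proof.
move=> [Dx Nx] _ [u [Hu Nu] <-]; split; first exact: D4_mul_hurwitz.
by rewrite -[LHS]/(sqnorm _) sqnormM Nu mulr1.
Qed.

Lemma finite_D4_shell n : finite_set (D4_shell R n).
Proof.
(* An integer a satisfies |a| <= a^2, so the coordinates lie in [-n, n]; shifting by n encodes them
   as ordinals below 2n+1. *)
pose f (w : 'cV['I_(n + n).+1]_4) : 'cV[R]_4 :=
  \col_i ((w i 0 : nat)%:R - n%:R).
apply: (@sub_finite_set _ _ (range f)); last first.
  exact/finite_image/finite_finset.
move=> x [[z _ zx] Nx].
have zn i : `|z i 0| <= n%:Z.
  rewrite -(ler_int R); have : `|z i 0|%:~R <= (z i 0)%:~R ^+ 2 :> R.
    rewrite -rmorphXn /= ler_int -[leRHS]real_normK ?num_real//.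
    have [->|z0] := eqVneq (z i 0) 0; first by rewrite normr0.
    by rewrite expr2 ler_peMl // -gtz0_ge1 normr_gt0.
  move=> /le_trans; apply; rewrite -pmulrn -Nx (bigD1 i)//= -zx mxE lerDl.
  by apply: sumr_ge0 => j _; exact: sqr_ge0.
have zn' i : (absz (z i 0 + n%:Z)%R < (n + n).+1)%N by have := zn i; lia.
exists (\col_i Ordinal (zn' i)) => //.
apply/matrixP => i j; rewrite ord1 !mxE /= -zx mxE.
have -> : (absz (z i 0 + n%:Z))%:R = (z i 0 + n%:Z)%:~R :> R.
  by rewrite pmulrn; congr (_%:~R); have := zn i; lia.
by rewrite intrD addrK.
Qed.

(** * The rotation attached to a coset *)

Definition coset_rotation (m : nat) x : 'M[R]_4 :=
  (2 * Num.sqrt m%:R)^-1 *: lmulq (lmulq x *m quat 1 (-1) 0 0).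

(** As 1-i has squared norm 2, x(1-i) has squared norm 4m, which the factor 1/(2√m) normalises to
    1. *)
Lemma coset_rotation_orthogonal (m : nat) x : (1 <= m)%N ->
  sqnorm x = (2 * m)%N%:R -> orthogonal_group R (coset_rotation m x).
Proof.
move=> m1 Nx; rewrite /orthogonal_group /= /coset_rotation.
rewrite [_^T]linearZ /= -scalemxAl -scalemxAr scalerA lmulq_tr_mul sqnormM Nx.
rewrite sqnorm_quat scale_scalar_mx; congr (_%:M).
rewrite -expr2 exprVn exprMn sqr_sqrtr ?ler0n// natrM.
by field; rewrite pnatr_eq0 -lt0n.
Qed.

(** From (1-i)(1+i) = 2, the rotation sends (1+i)u/√2 to xu/√(2m) for every unit u. *)
Lemma coset_rotation_roots (m : nat) x :
  mulmx (coset_rotation m x) @` dilate (Num.sqrt 2%:R)^-1 (D4_roots R) =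
  dilate (Num.sqrt (2 * m)%N%:R)^-1 (unit_coset x).
Proof.
have E u : coset_rotation m x *m
    ((Num.sqrt 2%:R)^-1 *: (lmulq (quat 1 1 0 0) *m u)) =
    (Num.sqrt (2 * m)%N%:R)^-1 *: (lmulq x *m u).
  rewrite -scalemxAr -scalemxAl scalerA lmulqM -!mulmxA.
  rewrite [lmulq (quat 1 (-1) 0 0) *m _]mulmxA.
  have -> : quat 1 (-1) 0 0 = conjq (quat 1 1 0 0).
    by rewrite /conjq !mxE /= oppr0.
  rewrite -trmx_lmulq lmulq_tr_mul mul_scalar_mx -scalemxAr scalerA.
  congr (_ *: _).
  rewrite natrM sqrtrM ?ler0n// sqnorm_quat !invfM.
  (* With the inverse roots generalised to variables, [field] only has to invert 2. *)
  move: (Num.sqrt 2)^-1 (Num.sqrt m%:R)^-1 => s2 sm.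
  by field.
rewrite D4_rootsE eqEsubset; split.
  move=> _ [_ [_ [u Uu <-] <-] <-]; rewrite E.
  by exists (lmulq x *m u) => //; exists u.
move=> _ [_ [u Uu <-] <-]; rewrite -E.
by exists ((Num.sqrt 2)^-1 *: (lmulq (quat 1 1 0 0) *m u)) => //;
  exists (lmulq (quat 1 1 0 0) *m u) => //; exists u.
Qed.

End Quaternions.

Theorem theorem6p1 (R : realType) (m : nat) (m_ge1 : (1 <= m)%N) :
  exists S : set 'M[R]_4,
    [/\ finite_set S,
        S `<=` orthogonal_group R,
        dilate (Num.sqrt (2 * m)%N%:R)^-1 (D4_shell R (2 * m)) =
          \bigcup_(s in S)
            (mulmx s @` dilate (Num.sqrt 2%:R)^-1 (D4_roots R)) &
        trivIset S
          (fun s => mulmx s @` dilate (Num.sqrt 2%:R)^-1 (D4_roots R))].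
Proof.
(* The choice depends only on the coset as a set, so equal cosets get the same representative and
   hence the same rotation. The default 0 is never returned, since x lies in its coset. *)
pose rep (x : 'cV[R]_4) := xget 0 (unit_coset x).
have repP x : unit_coset x (rep x).
  by apply: (@xgetPex _ 0); exists x; exact: unit_coset_refl.
have repE x : unit_coset (rep x) = unit_coset x by exact: unit_coset_eq.
exists [set coset_rotation m (rep x) | x in D4_shell R (2 * m)]; split.
- exact/finite_image/finite_D4_shell.
- move=> _ [x Dx <-]; apply: coset_rotation_orthogonal => //.
  by have [] := unit_coset_shell Dx (repP x).
- rewrite eqEsubset; split=> [_ [x Dx <-]|y [_ [x Dx <-]]].
    exists (coset_rotation m (rep x)); first by exists x.
    rewrite coset_rotation_roots repE; exists x => //.
    exact: unit_coset_refl.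
  rewrite coset_rotation_roots repE => -[z xz <-]; exists z => //.
  exact: unit_coset_shell xz.
- move=> _ _ [x Dx <-] [y Dy <-]; rewrite !coset_rotation_roots !repE.
  have c_neq0 : (Num.sqrt (2 * m)%N%:R)^-1 != 0 :> R.
    by rewrite invr_eq0 sqrtr_eq0 -ltNge ltr0n muln_gt0.
  (* A common point of two images gives, after cancelling the scalar, a common point of the two
     cosets; these coincide, and so do the rotations. *)
  move=> [_ [[v xv <-] [w yw /(scalerI c_neq0) wv]]].
  by rewrite /rep -(unit_coset_eq xv) -(unit_coset_eq yw) wv.
Qed.
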